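(* Let $\mu$ be a nonzero Radon measure on $\mathbb{R}$ satisfying both (i) whenever $f,g$ are extended real-valued Borel functions on $\mathbb{R}$ with $f=g$ $\mu$-a.e., then $T_t(f)=T_t(g)$ $\mu$-a.e. for all $t\in\mathbb{R}$; and (ii) an extended real-valued Borel function $f$ on $\mathbb{R}$ is $\mu$-essentially bounded if and only if $T_t(f)$ is $\mu$-essentially bounded for all $t\in\mathbb{R}$. Then there exist a bounded function $f\in L^\infty(\mu)$ and a bounded linear functional $\rho:L^\infty(\mu)\to\mathbb{R}$ such that $$\lim_{t\to 0}\rho(T_t(f))\ \text{ exists but }\ \lim_{t\to 0}\rho(T_t(f))\neq\rho(f).$$ In particular, $\{T_t\}$ is not weakly continuous on $L^\infty(\mu)$.
   Context: A Radon measure on $\mathbb{R}$ is a positive Borel measure $\mu$ on $\mathbb{R}$ with $\mu([-n,n])<\infty$ for all $n\in\mathbb{N}$. For an extended real-valued function $f$ on $\mathbb{R}$ and $t\in\mathbb{R}$, $T_t(f)(x)=f(x-t)$. Under (i) and (ii) the $T_t$ act on $L^\infty(\mu)$ as a group of linear operators on equivalence classes. Weak continuity of $\{T_t\}$ on $L^\infty(\mu)$ refers to continuity of $t\mapsto\rho(T_t(f))$ for every $f\in L^\infty(\mu)$ and every bounded linear functional $\rho$ on $L^\infty(\mu)$. *)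

(* Defs.v *)
From HB Require Import structures.
From mathcomp Require Import all_boot all_order all_algebra generic_quotient.
From mathcomp Require Import all_classical all_reals all_analysis.
From mathcomp Require Import measurable_realfun ess_sup_inf.

Set Implicit Arguments.
Unset Strict Implicit.
Unset Printing Implicit Defensive.

Import Order.TTheory GRing.Theory Num.Def Num.Theory.
Import numFieldNormedType.Exports.

Local Open Scope classical_set_scope.
Local Open Scope ring_scope.

(* [LspaceType mu p1] is the library's type of classes, modulo a.e. equality,
   of measurable functions with finite p-norm; the library gives it no
   algebraic structure.  This section makes it a normed module, with the
   operations and the norm induced by representatives. *)
Section Lspace_normedModule.
Context d (T : measurableType d) (R : realType).
Variables (mu : {measure set T -> \bar R}) (p : \bar R) (p1 : (1 <= p)%E).
Local Notation LF := (LfunType mu p1).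
Local Notation LS := (LspaceType mu p1).
Local Notation Q := {mfun_ mu, T >-> measurableTypeR R}.
Local Open Scope quotient_scope.

Lemma ae_eq_Lnorm (f g : T -> R) :
  measurable_fun setT f -> measurable_fun setT g -> f = g %[ae mu] ->
  'N[mu]_p[EFin \o f]%E = 'N[mu]_p[EFin \o g]%E.
Proof.
move=> mf mg fg; rewrite unlock /Lnorm; case: p p1 => [r _|_|//].
- have mN (h : T -> R) : measurable_fun setT h ->
      measurable_fun setT (fun x => `|(h x)%:E| `^ r)%E.
    move=> mh; apply: (measurableT_comp (measurable_poweR r)
      (g := fun x => `|(h x)%:E|%E)).
    by apply: measurableT_comp => //; exact/measurable_EFinP.
  congr (_ `^ _)%E; apply: ae_eq_integral => //; [exact: mN|exact: mN|].
  by apply: filterS fg => x /= /(_ I) -> _.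
- case: ifP => // _; apply: eq_ess_sup.
  by apply: filterS fg => x /= /(_ I) ->.
Qed.

Lemma pi_ae_eq (f g : {mfun T >-> measurableTypeR R}) :
  (\pi_Q f = \pi_Q g) <-> (f : T -> R) = g %[ae mu].
Proof.
split; first by move=> /eqquotP/asboolP.
by move=> fg; apply/eqquotP/asboolP.
Qed.

Lemma repr_pi_ae (f : {mfun T >-> measurableTypeR R}) :
  (repr (\pi_Q f) : T -> R) = f %[ae mu].
Proof. by apply/pi_ae_eq; rewrite reprK. Qed.

Lemma Lfun_mfun_subproof (f : LF) :
  (f : T -> measurableTypeR R) \in @mfun _ _ T (measurableTypeR R).
Proof. by apply: mem_set; exact: (@measurable_funPT _ _ T R f). Qed.

Definition mfun_of_Lfun (f : LF) : {mfun T >-> measurableTypeR R} :=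
  mfun_Sub (Lfun_mfun_subproof f).

Lemma mfun_of_LfunE (f : LF) : (mfun_of_Lfun f : T -> R) = f.
Proof. by []. Qed.

Lemma finite_norm_pi (f : LF) :
  finite_norm mu p (repr (\pi_Q (mfun_of_Lfun f))).
Proof.
rewrite /finite_norm (@ae_eq_Lnorm _ f).
- exact: Lfunction_finite.
- exact: (@measurable_funPT _ _ T (measurableTypeR R) (repr (\pi_Q _))).
- exact: measurable_funPT.
- exact: repr_pi_ae.
Qed.

Definition Lclass (f : LF) : LS :=
  LebesgueSpace.Pack (LebesgueSpace.Class
    (isFinLebesgue.Build _ _ _ _ _ p1 _ (finite_norm_pi f))).

Lemma Lrepr_subproof (u : LS) : (u : T -> R) \in Lfun mu p.
Proof.
apply/andP; split; apply: mem_set.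
  exact: (@measurable_funPT _ _ T (measurableTypeR R) (repr (LebesgueSpace.sort u))).
exact: Lebesgue_finite.
Qed.

Definition Lrepr (u : LS) : LF := Lfun_Sub p1 (Lrepr_subproof u).

Lemma LspaceP (u v : LS) : (u : T -> R) = v %[ae mu] <-> u = v.
Proof.
split=> [uv|->]; last exact: ae_eq_refl.
have : LebesgueSpace.sort u = LebesgueSpace.sort v.
  by rewrite -[LHS]reprK -[RHS]reprK; apply/pi_ae_eq.
case: u v {uv} => [u [[fu]]] [v [[fv]]] /= uv.
by case: _ / uv fv => fv; rewrite (Prop_irrelevance fu fv).
Qed.

Lemma Lclass_ae (f : LF) : (Lclass f : T -> R) = f %[ae mu].
Proof. exact: repr_pi_ae. Qed.

Lemma Lclass_eq (f g : LF) : Lclass f = Lclass g <-> (f : T -> R) = g %[ae mu].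
Proof.
split=> [fg|fg].
  apply: (ae_eq_trans (ae_eq_sym (Lclass_ae f))); rewrite fg.
  exact: Lclass_ae.
apply/LspaceP; apply: (ae_eq_trans (Lclass_ae f)).
exact: (ae_eq_trans fg (ae_eq_sym (Lclass_ae g))).
Qed.

Lemma LreprK : cancel Lrepr Lclass.
Proof. by move=> u; apply/LspaceP; exact: Lclass_ae. Qed.

HB.instance Definition _ := gen_eqMixin LS.
HB.instance Definition _ := gen_choiceMixin LS.

Definition Lspace_zero : LS := Lclass 0.
Definition Lspace_opp (u : LS) : LS := Lclass (- Lrepr u).
Definition Lspace_add (u v : LS) : LS := Lclass (Lrepr u + Lrepr v).
Definition Lspace_scale (a : R) (u : LS) : LS := Lclass (a *: Lrepr u).
Definition Lspace_norm (u : LS) : R := fine 'N[mu]_p[EFin \o Lrepr u]%E.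

Lemma Lspace_addE (f g : LF) :
  Lspace_add (Lclass f) (Lclass g) = Lclass (f + g).
Proof.
apply/Lclass_eq; move: (Lclass_ae f) (Lclass_ae g); apply: filterS2.
by move=> x fx gx _; exact: (congr2 +%R (fx I) (gx I)).
Qed.

Lemma Lspace_oppE (f : LF) : Lspace_opp (Lclass f) = Lclass (- f).
Proof.
apply/Lclass_eq; move: (Lclass_ae f); apply: filterS.
by move=> x fx _; exact: (congr1 -%R (fx I)).
Qed.

Lemma Lspace_scaleE a (f : LF) : Lspace_scale a (Lclass f) = Lclass (a *: f).
Proof.
apply/Lclass_eq; move: (Lclass_ae f); apply: filterS.
by move=> x fx _; exact: (congr1 ( *%R a) (fx I)).
Qed.

Lemma Lspace_normE (f : LF) :
  Lspace_norm (Lclass f) = fine 'N[mu]_p[EFin \o f]%E.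
Proof. by congr fine; apply: ae_eq_Lnorm => //; exact: Lclass_ae. Qed.

Let addA : associative Lspace_add.
Proof.
move=> u v w; rewrite -(LreprK u) -(LreprK v) -(LreprK w) !Lspace_addE.
by rewrite addrA.
Qed.

Let addC : commutative Lspace_add.
Proof. by move=> u v; rewrite /Lspace_add addrC. Qed.

Let add0 : left_id Lspace_zero Lspace_add.
Proof. by move=> u; rewrite -(LreprK u) Lspace_addE add0r. Qed.

Let addN : left_inverse Lspace_zero Lspace_opp Lspace_add.
Proof.
by move=> u; rewrite -(LreprK u) Lspace_oppE Lspace_addE addNr.
Qed.

HB.instance Definition _ := GRing.isZmodule.Build LS addA addC add0 addN.

Let scaleA a b (u : LS) :
  Lspace_scale a (Lspace_scale b u) = Lspace_scale (a * b) u.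
Proof. by rewrite -(LreprK u) !Lspace_scaleE scalerA. Qed.

Let scale1 : left_id 1 Lspace_scale.
Proof. by move=> u; rewrite -(LreprK u) Lspace_scaleE scale1r. Qed.

Let scaleDr : right_distributive Lspace_scale +%R.
Proof.
move=> a u v; rewrite -(LreprK u) -(LreprK v) [_ + _]Lspace_addE.
by rewrite !Lspace_scaleE [RHS]Lspace_addE scalerDr.
Qed.

Let scaleDl (u : LS) : {morph Lspace_scale^~ u : a b / a + b}.
Proof.
move=> a b; rewrite -(LreprK u) !Lspace_scaleE [RHS]Lspace_addE.
by rewrite scalerDl.
Qed.

HB.instance Definition _ :=
  GRing.Zmodule_isLmodule.Build R LS scaleA scale1 scaleDr scaleDl.

Let normD (u v : LS) : Lspace_norm (u + v) <= Lspace_norm u + Lspace_norm v.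
Proof.
by rewrite -(LreprK u) -(LreprK v) [_ + _]Lspace_addE !Lspace_normE ler_LnormD.
Qed.

Let normZ a (u : LS) : Lspace_norm (a *: u) = `|a| * Lspace_norm u.
Proof.
rewrite -(LreprK u) [_ *: _]Lspace_scaleE !Lspace_normE; apply: EFin_inj.
by rewrite EFinM !finite_norm_fine; exact: LnormZ.
Qed.

Let norm0_eq0 (u : LS) : Lspace_norm u = 0 -> u = 0.
Proof.
by move=> /fine_Lnormr_eq0 u0; rewrite -(LreprK u); apply/Lclass_eq.
Qed.

HB.instance Definition _ :=
  Lmodule_isNormed.Build R LS normD normZ norm0_eq0.

Lemma LclassD (f g : LF) : Lclass (f + g) = Lclass f + Lclass g.
Proof. by rewrite [RHS]Lspace_addE. Qed.

Lemma LclassZ a (f : LF) : Lclass (a *: f) = a *: Lclass f.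
Proof. by rewrite [RHS]Lspace_scaleE. Qed.

Lemma norm_Lclass (f : LF) : `|Lclass f| = fine 'N[mu]_p[EFin \o f]%E.
Proof. exact: Lspace_normE. Qed.

End Lspace_normedModule.

Notation Linfty mu := (LspaceType mu (leey 1)).
Notation Linfty_fun mu := (LfunType mu (leey 1)).

(* [measurableTypeR R] is R equipped with its Borel sigma-algebra. *)
Section translation.
Context (R : realType) (mu : {measure set (measurableTypeR R) -> \bar R}).

Definition radon_measure : Prop :=
  forall n : nat, (mu `[(- n%:R)%R, n%:R%R]%classic < +oo)%E.

Definition transl U (t : R) (f : measurableTypeR R -> U) :
  measurableTypeR R -> U := fun x : R => f (x - t).

Definition ess_bounded (f : measurableTypeR R -> \bar R) : Prop :=
  exists M : R, \forall x \ae mu, (`|f x| <= M%:E)%E.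

Definition transl_ae_compatible : Prop :=
  forall f g : measurableTypeR R -> \bar R,
    measurable_fun setT f -> measurable_fun setT g ->
    f = g %[ae mu] -> forall t : R, transl t f = transl t g %[ae mu].

Definition transl_ess_bounded : Prop :=
  forall f : measurableTypeR R -> \bar R, measurable_fun setT f ->
    (ess_bounded f <-> forall t : R, ess_bounded (transl t f)).

Lemma finite_normyP (f : measurableTypeR R -> R) :
  finite_norm mu +oo f <-> ess_bounded (EFin \o f).
Proof.
rewrite /finite_norm unlock /Lnorm; split; last first.
  move=> [M fM]; case: ifPn => [_|_]; last exact: ltry.
  by apply: (@le_lt_trans _ _ M%:E); [exact/ess_supP|exact: ltry].
case: ifPn => [mu0 foo|].
  exists (fine (maxe (ess_sup mu (abse \o (EFin \o f))) 0)).
  apply: filterS (ess_sup_ge mu (abse \o (EFin \o f))) => x.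
  case: (ess_sup _ _) foo => [y| |] //= _ fy.
  by rewrite -EFin_max/=; apply: (le_trans fy); rewrite lee_fin le_max lexx.
rewrite lt0e measure_ge0 andbT negbK => /eqP mu0 _; exists 0.
by exists setT; split.
Qed.

Lemma measurable_transl d (U : measurableType d) t
    (f : measurableTypeR R -> U) :
  measurable_fun setT f -> measurable_fun setT (transl t f).
Proof.
move=> mf; apply: (measurableT_comp mf (g := fun x : R => x - t)).
exact: measurable_funB.
Qed.

Lemma ae_eq_transl (f g : measurableTypeR R -> R) : transl_ae_compatible ->
  measurable_fun setT f -> measurable_fun setT g ->
  f = g %[ae mu] -> forall t, transl t f = transl t g %[ae mu].
Proof.
move=> mu_ae mf mg fg t.
have := mu_ae (EFin \o f) (EFin \o g); rewrite !measurable_EFinP.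
move=> /(_ mf mg _ t) H.
have {}H : transl t (EFin \o f) = transl t (EFin \o g) %[ae mu].
  by apply: H; apply: filterS fg => x fg /fg /= ->.
by apply: filterS H => x H /H [].
Qed.

Lemma Lfun_transl_subproof (mu_bdd : transl_ess_bounded) t (f : Linfty_fun mu) :
  transl t f \in Lfun mu +oo.
Proof.
have mf : measurable_fun setT f by exact: measurable_funPT.
apply/andP; split; apply: mem_set; first exact: measurable_transl.
apply/finite_normyP; apply: ((mu_bdd (EFin \o f) _).1 _ t).
  exact/measurable_EFinP.
by apply/finite_normyP; exact: Lfunction_finite.
Qed.

Definition Lfun_transl (mu_bdd : transl_ess_bounded) t (f : Linfty_fun mu) :
  Linfty_fun mu := Lfun_Sub (leey 1) (Lfun_transl_subproof mu_bdd t f).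

(* The translate of a class is the class of the translate of its canonical
   representative; [transl_ess_bounded] keeps it in L^infty, and independence
   of the representative is [Linfty_translE]. *)
Definition Linfty_transl (mu_bdd : transl_ess_bounded) t (u : Linfty mu) :
  Linfty mu := Lclass (Lfun_transl mu_bdd t (Lrepr u)).

Lemma Linfty_translE (mu_ae : transl_ae_compatible)
    (mu_bdd : transl_ess_bounded) t (f : Linfty_fun mu) :
  Linfty_transl mu_bdd t (Lclass f) = Lclass (Lfun_transl mu_bdd t f).
Proof.
apply/Lclass_eq/ae_eq_transl => //; try exact: measurable_funPT.
exact: Lclass_ae.
Qed.

Lemma Linfty_transl0 (mu_ae : transl_ae_compatible)
    (mu_bdd : transl_ess_bounded) : Linfty_transl mu_bdd 0 =1 id.
Proof.
move=> u; rewrite -(LreprK u) Linfty_translE//; congr Lclass.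
by apply/LfuneqP => x /=; rewrite /transl subr0.
Qed.

Lemma Linfty_translD (mu_ae : transl_ae_compatible)
    (mu_bdd : transl_ess_bounded) s t (u : Linfty mu) :
  Linfty_transl mu_bdd (s + t) u =
  Linfty_transl mu_bdd s (Linfty_transl mu_bdd t u).
Proof.
rewrite -(LreprK u) !Linfty_translE//; congr Lclass.
by apply/LfuneqP => x /=; rewrite /transl opprD addrA.
Qed.

Lemma Linfty_transl_linear (mu_ae : transl_ae_compatible)
    (mu_bdd : transl_ess_bounded) t : linear (Linfty_transl mu_bdd t).
Proof.
move=> a u v; rewrite -(LreprK u) -(LreprK v) -LclassZ -LclassD.
by rewrite !Linfty_translE// -LclassZ -LclassD; congr Lclass; apply/LfuneqP.
Qed.

Definition bounded_functional (rho : {linear Linfty mu -> R^o}) : Prop :=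
  exists C : R, forall u : Linfty mu, `|rho u| <= C * `|u|.

Definition weakly_continuous (T : R -> Linfty mu -> Linfty mu) : Prop :=
  forall (f : Linfty mu) (rho : {linear Linfty mu -> R^o}),
    bounded_functional rho -> continuous (fun t : R => rho (T t f) : R).

End translation.

(* Main.v *)
Require Import Defs.
From HB Require Import structures.
From mathcomp Require Import all_boot all_order all_algebra.
From mathcomp Require Import all_classical all_reals all_analysis.
From mathcomp Require Import measurable_realfun ess_sup_inf.
From mathcomp Require Import lra.

Set Implicit Arguments.
Unset Strict Implicit.
Unset Printing Implicit Defensive.

Import Order.TTheory GRing.Theory Num.Def Num.Theory.
Import numFieldNormedType.Exports.

Local Open Scope classical_set_scope.
Local Open Scope ring_scope.

(** The function is the Heaviside step [f = \1_`[0, +oo[] and the functional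
    [rho] measures the jump of a function at the origin.  The step has jump 1
    at 0, whereas for [t != 0] its translate by [t] is constant near 0 and has
    jump 0.  So [rho (T_t f)] vanishes on the whole punctured line while
    [rho f = 1], and the limit 0 differs from [rho f].  Weak continuity at
    [t = 0] would force the two to agree, because [T_0] is the identity.

    Elements of L^oo(mu) are classes modulo null sets, so the jump has to be
    read off averages: [rho u] is a generalised limit, as [n] grows, of the
    mu-average of [u] over ]0, 1/(n+1)[ minus its mu-average over
    ]-1/(n+1), 0[ ([jump_functional]).  These differences are linear in [u]
    and bounded by [2 * `|u|], but converge only for special [u]; taking the
    limit along an ultrafilter finer than [\oo] makes it exist for every [u]
    and stay linear and bounded ([functional_ultralimit]).

    The averages make sense because each of these intervals has finite mass,
    mu being Radon, and positive mass: a null open interval would have only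
    null translates, and countably many of them cover the line, which would
    make [mu] zero ([open_itv_gt0]). *)

(** * Generalised limits of bounded families of functionals *)

Lemma ultra_fmap (T U : Type) (s : T -> U) (F : set_system T) :
  UltraFilter F -> UltraFilter (s @ F).
Proof.
move=> FU; have FP := @ultra_proper _ _ FU; split.
  exact: fmap_proper_filter.
move=> G GP sFG; apply/seteqP; split=> // A GA.
have [//|FnA] := in_ultra_setVsetC (s @^-1` A) FU.
have GnA : G (~` A) by exact: sFG.
by have [x []] := filter_ex (filterI GA GnA).
Qed.

Lemma bounded_ultra_cvg (R : realType) (T : Type) (F : set_system T)
    (s : T -> R) (M : R) : UltraFilter F ->
  (forall i, `|s i| <= M) -> exists l : R, s @ F --> l.
Proof.
move=> FU sM; have := @segment_compact R (- M) M; rewrite compact_ultra.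
have FP := @ultra_proper _ _ FU.
move=> /(_ _ (ultra_fmap s FU)) cvgs.
have /cvgs[l [_ sl]] : (s @ F) `[- M, M]%classic; last by exists l.
by apply: (@filterE _ F) => i; rewrite /= in_itv /= -ler_norml.
Qed.

(** A pointwise bounded family has a limit along an ultrafilter finer than [F]
    at every vector, by compactness of segments; uniqueness of limits makes
    these limits linear in the vector, and forces them to agree with the limits
    along [F] wherever the latter exist. *)
Lemma functional_ultralimit (R : realType) (V : normedModType R) (T : Type)
    (F : set_system T) (A : T -> V -> R^o) (C : R) : ProperFilter F ->
  (forall i, linear (A i)) -> (forall i u, `|A i u| <= C * `|u|) ->
  exists rho : {linear V -> R^o},
    (forall u, `|rho u| <= C * `|u|) /\
    forall u (l : R), A i u @[i --> F] --> l -> rho u = l.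
Proof.
move=> FP Alin AC; have [G [GU FG]] := ultraFilterLemma FP.
have GP := @ultra_proper _ _ GU.
have /choice[rho rhoP] : forall u, exists l : R, (A i u : R) @[i --> G] --> l.
  by move=> u; apply: (bounded_ultra_cvg GU) => i; exact: AC.
have rho_uniq u (l : R) : (A i u : R) @[i --> G] --> l -> rho u = l.
  by move=> ul; apply: (cvg_unique _ (rhoP u) ul).
have rho_lin : linear (rho : V -> R^o).
  move=> a u v; apply: rho_uniq.
  under eq_fun do rewrite Alin.
  by apply: cvgD; [apply: cvgM; [exact: cvg_cst|exact: rhoP]|exact: rhoP].
pose rhoL := GRing.isLinear.Build R V R^o *:%R rho rho_lin.
exists (HB.pack_for {linear V -> R^o} (rho : V -> R^o) rhoL).
split=> /= [u|u l ul]; last by apply: rho_uniq => B lB; apply: FG; exact: ul.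
have nA : `|A i u : R| @[i --> G] --> `|rho u| by apply: cvg_norm; exact: rhoP.
apply: (@closed_cvg _ _ G GP _ [set x : R | x <= C * `|u|] _ _ _ nA).
  exact: closed_le.
by apply: (@filterE _ G) => i; exact: AC.
Qed.

(** * Averages of essentially bounded functions *)

Lemma measurable_Lrepr d (T : measurableType d) (R : realType)
    (mu : {measure set T -> \bar R}) (D : set T) (u : Linfty mu) :
  measurable_fun D (EFin \o Lrepr u).
Proof.
by apply/measurable_EFinP; apply: measurable_funTS; exact: measurable_funPT.
Qed.

Lemma Linfty_norm_ge d (T : measurableType d) (R : realType)
    (mu : {measure set T -> \bar R}) (u : Linfty mu) :
  \forall x \ae mu, `|Lrepr u x| <= `|u|.
Proof.
have -> : `|u| = fine 'N[mu]_+oo[EFin \o Lrepr u]%E.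
  by rewrite -norm_Lclass LreprK.
have : finite_norm mu +oo (Lrepr u) by exact: Lfunction_finite.
rewrite /finite_norm unlock /Lnorm; case: ifPn => [_ uoo|].
  apply: filterS (ess_sup_ge mu (abse \o (EFin \o Lrepr u))) => x /=.
  by case: (ess_sup _ _) uoo.
(* When mu is zero the L^oo norm is 0 by convention, and every set is null. *)
rewrite lt0e measure_ge0 andbT negbK => /eqP mu0 _.
by exists setT; split.
Qed.

Section average.
Context d (T : measurableType d) (R : realType).
Variables (mu : {measure set T -> \bar R}) (D : set T).
Hypotheses (mD : measurable D) (D_gt0 : (0 < mu D)%E) (D_fin : (mu D < +oo)%E).

Definition average (u : Linfty mu) : R^o :=
  (fine (mu D))^-1 * \int[mu]_(x in D) Lrepr u x.

Let fD_gt0 : 0 < fine (mu D).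
Proof. by rewrite fine_gt0// D_gt0. Qed.

Lemma Linfty_integrable (u : Linfty mu) :
  mu.-integrable D (EFin \o Lrepr u).
Proof.
apply/integrableP; split; first exact: measurable_Lrepr.
apply: (@le_lt_trans _ _ (`|u|%:E * mu D)%E).
  apply: integral_le_bound => //; first exact: measurable_Lrepr.
  by apply: filterS (Linfty_norm_ge u) => x ? _.
by rewrite lte_mul_pinfty.
Qed.

Lemma average_Lclass (f : Linfty_fun mu) :
  average (Lclass f) = (fine (mu D))^-1 * \int[mu]_(x in D) f x.
Proof.
congr (_ * fine _); apply: ae_eq_integral => //.
- exact: measurable_Lrepr.
- by apply/measurable_EFinP; apply: measurable_funTS; exact: measurable_funPT.
- by apply: filterS (Lclass_ae f) => x /(_ I) /= ->.
Qed.

Lemma average_linear : linear average.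
Proof.
move=> a u v.
rewrite -{1}(LreprK u) -{1}(LreprK v) -LclassZ -LclassD average_Lclass.
have intau : mu.-integrable D (EFin \o (fun x => a * Lrepr u x)).
  exact: (integrableZl mD a (Linfty_integrable u)).
rewrite (RintegralD mD intau (Linfty_integrable v)).
by rewrite (RintegralZl _ mD (Linfty_integrable u)) mulrDr mulrCA.
Qed.

Lemma average_norm_le (u : Linfty mu) : `|average u| <= `|u|.
Proof.
rewrite normrM ger0_norm ?invr_ge0 ?(ltW fD_gt0)// ler_pdivrMl//.
rewrite -lee_fin EFinM (EFin_normr_Rintegral mD (Linfty_integrable u)).
apply: le_trans.
  by apply: le_abse_integral => //; exact: measurable_Lrepr.
rewrite fineK ?ge0_fin_numE// muleC.
apply: integral_le_bound => //; first exact: measurable_Lrepr.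
by apply: filterS (Linfty_norm_ge u) => x ? _.
Qed.

Lemma average_cst (f : Linfty_fun mu) (c : R) :
  (forall x, D x -> f x = c) -> average (Lclass f) = c.
Proof.
move=> fc; rewrite average_Lclass (@eq_Rintegral _ _ _ _ _ (cst c)).
  by rewrite Rintegral_cst// mulrC mulfK// gt_eqF.
by move=> x /set_mem /fc.
Qed.

End average.

Lemma bounded_Lfun (R : realType)
    (mu : {measure set (measurableTypeR R) -> \bar R})
    (f : measurableTypeR R -> R) (M : R) :
  measurable_fun setT f -> (forall x, `|f x| <= M) -> f \in Lfun mu +oo.
Proof.
move=> mf fM; apply/andP; split; apply: mem_set => //.
by apply/finite_normyP; exists M; apply: filterE => x /=; rewrite lee_fin.
Qed.

(** * Radon measures with translation-invariant null sets *)

Lemma radon_lty (R : realType)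
    (mu : {measure set (measurableTypeR R) -> \bar R})
    (B : set (measurableTypeR R)) (n : nat) : radon_measure mu ->
  measurable B -> B `<=` `[- n%:R, n%:R]%classic -> (mu B < +oo)%E.
Proof.
move=> mu_radon mB Bn; apply: (le_lt_trans _ (mu_radon n)).
by apply: le_measure => //; rewrite inE//; exact: measurable_itv.
Qed.

Section quasi_invariance.
Context (R : realType) (mu : {measure set (measurableTypeR R) -> \bar R}).
Hypothesis mu_ae : transl_ae_compatible mu.

(** Compatibility with a.e. equality, applied to the indicator of A and 0. *)
Lemma negligible_transl (A : set (measurableTypeR R)) (t : R) :
  measurable A -> mu A = 0%E -> mu.-negligible [set x : R | A (x - t)].
Proof.
move=> mA A0.
have A_0 : (\1_A : measurableTypeR R -> R) = cst 0 %[ae mu].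
  exists A; split => // x /= /not_implyP[_ nA].
  apply: contrapT => nAx; apply: nA.
  by rewrite indicE memNset.
have := ae_eq_transl mu_ae (measurable_indic mA)
  (@measurable_cst _ _ _ _ _ _) A_0 t.
apply: negligibleS => x /= Ax /(_ I) /eqP.
by rewrite /transl indicE mem_set// oner_eq0.
Qed.

(** If ]a, b[ were null, so would be its translates by the rationals, which
    cover the line. *)
Lemma open_itv_gt0 (a b : R) : mu [set: measurableTypeR R] != 0%E -> a < b ->
  (0 < mu `]a, b[%classic)%E.
Proof.
move=> mu_neq0 ab; rewrite lt0e measure_ge0 andbT; apply/eqP => ab0.
move/eqP : mu_neq0; apply.
(* q enumerates the rationals; codes of no rational are sent to 0. *)
pose q n : R := ratr (odflt 0 (unpickle n)).
suff : mu.-negligible [set: measurableTypeR R].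
  by move/measure_negligible; apply.
have /negligible_bigcup := fun n : nat =>
  negligible_transl (q n) (measurable_itv `]a, b[) ab0.
apply: negligibleS => x _.
have [r] : exists r, ratr r \in `]x - b, x - a[ by apply: rat_in_itvoo; lra.
rewrite in_itv /= => /andP[r1 r2]; exists (pickle r) => //=.
by rewrite /q pickleK /= in_itv /=; lra.
Qed.

End quasi_invariance.

(** * The jump at the origin *)

(** The functional is a generalised limit of differences of averages over
    ]0, 1/(n+1)[ and ]-1/(n+1), 0[; on a function constant on each side of 0
    those differences are eventually equal to the jump. *)
Lemma jump_functional (R : realType)
    (mu : {measure set (measurableTypeR R) -> \bar R}) :
  radon_measure mu ->
  (forall a b : R, a < b -> (0 < mu `]a, b[%classic)%E) ->
  exists2 rho : {linear Linfty mu -> R^o}, bounded_functional rho &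
    forall (f : Linfty_fun mu) (e a b : R), 0 < e ->
      (forall x : R, 0 < x < e -> f x = a) ->
      (forall x : R, - e < x < 0 -> f x = b) ->
      rho (Lclass f) = a - b.
Proof.
move=> mu_radon mu_gt0.
pose h (n : nat) : R := n.+1%:R^-1.
have h0 n : 0 < h n by rewrite invr_gt0.
have h1 n : h n <= 1 by rewrite invf_le1// ler1n.
pose P n : set (measurableTypeR R) := `]0, h n[%classic.
pose N n : set (measurableTypeR R) := `](- h n), 0[%classic.
have mP n : measurable (P n) by exact: measurable_itv.
have mN n : measurable (N n) by exact: measurable_itv.
have P_gt0 n : (0 < mu (P n))%E by exact: mu_gt0.
have N_gt0 n : (0 < mu (N n))%E by apply: mu_gt0; rewrite oppr_lt0.
have P_fin n : (mu (P n) < +oo)%E.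
  apply: (radon_lty mu_radon (n := 1)) => //.
  by apply: subset_itv; rewrite bnd_simp// oppr_le0.
have N_fin n : (mu (N n) < +oo)%E.
  apply: (radon_lty mu_radon (n := 1)) => //.
  by apply: subset_itv; rewrite bnd_simp// lerN2.
pose A n (u : Linfty mu) : R^o := average (P n) u - average (N n) u.
have A_lin n : linear (A n).
  by move=> a u v; rewrite /A !average_linear// scalerBr opprD addrACA.
have A_le n u : `|A n u| <= 2 * `|u|.
  rewrite mulr_natl mulr2n (le_trans (ler_normB _ _))// lerD//.
    exact: average_norm_le.
  exact: average_norm_le.
have [rho [rho_le rhoE]] := functional_ultralimit (F := \oo) _ A_lin A_le.
exists rho; first by exists 2.
move=> f e a b e0 fa fb; apply: rhoE; apply: cvg_near_cst.
have : \forall n \near \oo, h n < e.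
  exact: (near_infty_natSinv_lt (PosNum e0)).
apply: filterS => n hn.
rewrite /A (average_cst (mP n) (P_gt0 n) (P_fin n) (c := a)); last first.
  move=> x; rewrite /P/= in_itv/= => /andP[x0 xh].
  by apply: fa; rewrite x0 (lt_trans xh).
rewrite (average_cst (mN n) (N_gt0 n) (N_fin n) (c := b))// => x.
rewrite /N/= in_itv/= => /andP[hx x0].
by apply: fb; rewrite x0 andbT (lt_trans _ hx)// ltrN2.
Qed.

Theorem theorem2 (R : realType)
  (mu : {measure set (measurableTypeR R) -> \bar R})
  (mu_radon : radon_measure mu)
  (mu_neq0 : mu [set: measurableTypeR R] != 0%E)
  (mu_ae : transl_ae_compatible mu)
  (mu_bdd : transl_ess_bounded mu) :
  (exists f : Linfty_fun mu,
     (exists M : R, forall x : R, `|(f : measurableTypeR R -> R) x| <= M) /\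
     exists rho : {linear Linfty mu -> R^o},
       bounded_functional rho /\
       exists l : R,
         rho (Linfty_transl mu_bdd t (Lclass f)) @[t --> (0 : R)^'] --> l /\
         l <> rho (Lclass f)) /\
  ~ weakly_continuous (Linfty_transl mu_bdd).
Proof.
have f0L : (\1_`[0, +oo[ : measurableTypeR R -> R) \in Lfun mu +oo.
  apply: (@bounded_Lfun _ _ _ 1); first exact: measurable_indic.
  by move=> x; rewrite indicE normr_nat lern1 leq_b1.
pose f : Linfty_fun mu := Lfun_Sub (leey 1) f0L.
have f1 (x : R) : 0 <= x -> f x = 1.
  by move=> x0; rewrite /= indicE mem_set//= in_itv/= x0.
have f0 (x : R) : x < 0 -> f x = 0.
  move=> x0; rewrite /= indicE memNset//= in_itv/= andbT.
  by apply/negP; rewrite -ltNge.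
have [rho rho_bdd rhoE] := jump_functional mu_radon
  (fun a b => @open_itv_gt0 _ _ mu_ae a b mu_neq0).
have rho_f : rho (Lclass f) = 1.
  rewrite (rhoE f 1 1 0) ?subr0// => x /andP[x0 x1].
    by rewrite f1// ltW.
  by rewrite f0.
have rho_tf (t : R) : t != 0 -> rho (Linfty_transl mu_bdd t (Lclass f)) = 0.
  rewrite Linfty_translE// neq_lt => /orP[] t0.
    rewrite (rhoE _ (- t) 1 1) ?subrr ?oppr_gt0// => x /andP[? ?].
      by apply: f1; lra.
    by apply: f1; lra.
  rewrite (rhoE _ t 0 0) ?subrr// => x /andP[? ?].
    by apply: f0; lra.
  by apply: f0; lra.
have rho_cvg :
    rho (Linfty_transl mu_bdd t (Lclass f)) @[t --> (0 : R)^'] --> (0 : R).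
  by apply: cvg_near_cst; near=> t; apply: rho_tf; near: t;
    exact: nbhs_dnbhs_neq.
split.
  exists f; split.
    by exists 1 => x; rewrite /= indicE normr_nat lern1 leq_b1.
  exists rho; split=> //; exists 0; split=> //.
  by rewrite rho_f => /esym/eqP; rewrite oner_eq0.
move=> /(_ (Lclass f) rho rho_bdd 0) /continuous_withinNx.
rewrite Linfty_transl0// rho_f => /(cvg_unique (@Rhausdorff R) rho_cvg).
by move/esym/eqP; rewrite oner_eq0.
Unshelve. all: by end_near. Qed.
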